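(* Let $G=(V,E)$ be a finite connected simple graph, let $\mathbf{U}$ be a universal adjacency matrix of $G$, and let $\lambda\in\mathrm{spec}(\mathbf{U})$ be an eigenvalue of $\mathbf{U}$. Then the collection $\mathcal{V}_\lambda=\{V_{\lambda,0},V_{\lambda,1},\dots,V_{\lambda,D_\lambda}\}$ is a partition of $V$.
   Context: Graphs are finite, undirected, connected, without loops or multiple edges, with vertex set $V=\{v_1,\dots,v_n\}$. Let $\mathbf{A}$ be the adjacency matrix, $\mathbf{D}$ the diagonal matrix of vertex degrees, $\mathbf{I}$ the identity and $\mathbf{J}$ the all-ones matrix, all $n\times n$. A universal adjacency matrix of $G$ is a matrix $\mathbf{U}=\gamma_A\mathbf{A}+\gamma_D\mathbf{D}+\gamma_I\mathbf{I}+\gamma_J\mathbf{J}$ with real scalars $\gamma_A\neq 0,\gamma_D,\gamma_I,\gamma_J$. For an eigenvalue $\lambda$ of $\mathbf{U}$, a vertex $v_i$ is a $\lambda$-core vertex if there is an eigenvector $\mathbf{x}$ with $\mathbf{U}\mathbf{x}=\lambda\mathbf{x}$ whose $i$-th entry is non-zero. $CV_\lambda$ denotes the set of $\lambda$-core vertices. With $d(u,v)$ the length of a shortest path between $u$ and $v$, define $d_\lambda(v)=\min\{d(v,u): u\in CV_\lambda\}$, $D_\lambda=\max\{d_\lambda(v): v\in V\}$, and $V_{\lambda,i}=\{v\in V: d_\lambda(v)=i\}$ for $0\le i\le D_\lambda$; in particular $V_{\lambda,0}=CV_\lambda$. *)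

(* Defs.v *)
From mathcomp Require Import all_boot all_order all_algebra.
From mathcomp Require Import boolp reals.

Set Implicit Arguments.
Unset Strict Implicit.
Unset Printing Implicit Defensive.

Import GRing.Theory.
Local Open Scope ring_scope.

Record connected_graph (n : nat) := ConnectedGraph {
  adj : rel 'I_n;
  adj_sym : symmetric adj;
  adj_irr : irreflexive adj;
  adj_conn : forall u v : 'I_n, connect adj u v }.

Section Distance.
Variables (n : nat) (G : connected_graph n).

Definition deg (v : 'I_n) : nat := #|[set u | adj G v u]|.

(* The vertices of the path are u :: p, so its length is size p = k. *)
Definition has_path (u v : 'I_n) (k : nat) : bool :=
  [exists p : k.-tuple 'I_n,
    [&& path (adj G) u p, last u p == v & uniq (u :: p)]].

Lemma ex_path (u v : 'I_n) : exists k, has_path u v k.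
Proof.
have /connectP[p0 p0P ->] := adj_conn G u v.
case/shortenP: p0P => p pP p_uniq _.
by exists (size p); apply/existsP; exists (in_tuple p); apply/and3P; split.
Qed.

Definition dist (u v : 'I_n) : nat := ex_minn (ex_path u v).

Lemma dist_lt (u v : 'I_n) : (dist u v < n)%N.
Proof.
rewrite /dist; case: ex_minnP => k /existsP[p /and3P[_ _ /card_uniqP up]] _.
by have := max_card [in u :: p]; rewrite up /= size_tuple card_ord.
Qed.

End Distance.

Section UniversalAdjacency.
Variables (R : realType) (n : nat) (G : connected_graph n).

Definition adjacency_mx : 'M[R]_n := \matrix_(i, j) (adj G i j)%:R.

Definition degree_mx : 'M[R]_n := diag_mx (\row_i (deg G i)%:R).

Definition universal_adjacency (U : 'M[R]_n) : Prop :=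
  exists gA gD gI gJ : R, gA != 0 /\
    U = gA *: adjacency_mx + gD *: degree_mx + gI *: 1%:M + gJ *: const_mx 1.

End UniversalAdjacency.

Section CoreVertices.
Variables (R : realType) (n : nat) (G : connected_graph n).
Variables (U : 'M[R]_n) (lambda : R).

(* A vector with a non-zero entry is non-zero, hence an eigenvector. *)
Definition core_vertices : {set 'I_n} :=
  [set i | `[< exists x : 'cV[R]_n, U *m x = lambda *: x /\ x i 0 != 0 >]].

(* By dist_lt the default n exceeds every distance, so this is the true minimum
   as soon as there is a core vertex, i.e. when lambda is an eigenvalue of U. *)
Definition core_dist (v : 'I_n) : nat :=
  \big[minn/n]_(u in core_vertices) dist G v u.

Definition max_core_dist : nat := \max_(v < n) core_dist v.

Definition core_layer (i : nat) : {set 'I_n} := [set v | core_dist v == i].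

Definition core_layers : {set {set 'I_n}} :=
  [set core_layer i | i : 'I_max_core_dist.+1].

End CoreVertices.

(* Main.v *)
Require Import Defs.
From mathcomp Require Import all_boot all_order all_algebra.
From mathcomp Require Import boolp reals.

Set Implicit Arguments.
Unset Strict Implicit.
Unset Printing Implicit Defensive.

Import Order.TTheory GRing.Theory.
Local Open Scope ring_scope.

(** The layers are the fibres of [core_dist], so they cover [V] and are pairwise
    disjoint; the point is that none is empty. As [U] is symmetric, a row
    eigenvector (the library's notion of eigenvalue) transposes to a column
    eigenvector, so a core vertex exists. The first step of a geodesic from a
    vertex at distance [k.+1] to a nearest core vertex leads to a vertex at
    distance exactly [k], so all values below an attained one are attained. *)

Section DistanceTheory.
Variables (n : nat) (G : connected_graph n).

(** [dist] minimises over paths without repeated vertices only; cutting the cycles out of a walk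
    keeps its ends and does not lengthen it. *)
Lemma dist_path_leq (u : 'I_n) (p : seq 'I_n) :
  path (adj G) u p -> (dist G u (last u p) <= size p)%N.
Proof.
case/shortenP=> q q_path q_uniq q_sub.
have q_size : (size q <= size p)%N.
  by apply: uniq_leq_size q_sub; case/andP: q_uniq.
apply: leq_trans q_size; rewrite /dist; case: ex_minnP => k _; apply.
apply/existsP; exists (in_tuple q); exact/and3P.
Qed.

Lemma geodesicP (u v : 'I_n) :
  exists p, [/\ path (adj G) u p, last u p = v & size p = dist G u v].
Proof.
rewrite /dist; case: ex_minnP => k /existsP[p /and3P[p_path /eqP p_last _]] _.
by exists p; split; rewrite ?size_tuple.
Qed.

Lemma dist_adj_leq (u v w : 'I_n) :
  adj G u v -> (dist G u w <= (dist G v w).+1)%N.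
Proof.
move=> uv; have [p [p_path <- <-]] := geodesicP v w.
by apply: (@dist_path_leq u (v :: p)); rewrite /= uv.
Qed.

End DistanceTheory.

Lemma universal_adjacency_sym (R : realType) (n : nat) (G : connected_graph n)
    (U : 'M[R]_n) : universal_adjacency G U -> U^T = U.
Proof.
case=> gA [gD [gI [gJ [_ ->]]]]; rewrite !linearD !linearZ /=.
rewrite tr_diag_mx trmx1 trmx_const; congr (_ *: _ + _ + _ + _).
by apply/matrixP=> i j; rewrite !mxE adj_sym.
Qed.

Section CoreDistance.
Variables (R : realType) (n : nat) (G : connected_graph n).
Variables (U : 'M[R]_n) (lambda : R).
Let core := core_vertices U lambda.
Let cdist := core_dist G U lambda.

Lemma exists_core_vertex :
  U^T = U -> eigenvalue U lambda -> exists u, u \in core.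
Proof.
move=> U_sym /eigenvalueP[x xU /rV0Pn[i xi]]; exists i.
rewrite inE; apply/asboolP; exists x^T; rewrite mxE; split=> //.
by rewrite -{1}U_sym -trmx_mul xU linearZ.
Qed.

Lemma core_dist_leq (u v : 'I_n) : u \in core -> (cdist v <= dist G v u)%N.
Proof. by move=> uP; exact: (bigmin_le_cond n (dist G v) uP). Qed.

(** The core is non-empty and no distance exceeds the default [n], so the default does not spoil the
    minimum. *)
Lemma core_dist_attained (u0 v : 'I_n) :
  u0 \in core -> exists2 u, u \in core & cdist v = dist G v u.
Proof.
move=> u0P; have dist_max u : u \in core -> (dist G v u <= n)%O.
  by move=> _; exact/ltnW/dist_lt.
by have [u uP vu] := eq_bigmin u0 _ _ u0P dist_max; exists u.
Qed.

Lemma core_dist_pred (u0 v : 'I_n) (k : nat) :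
  u0 \in core -> cdist v = k.+1 -> exists w, cdist w = k.
Proof.
move=> u0P vk; have [u uP vu] := core_dist_attained v u0P.
have [[|w p] [p_path p_last p_size]] := geodesicP G v u.
  by rewrite -vu vk in p_size.
case/andP: p_path => vw p_path; exists w; apply/eqP; rewrite eqn_leq.
apply/andP; split.
  (* Upper bound: the rest [p] of the geodesic joins [w] to [u] in [k] steps. *)
  apply: leq_trans (core_dist_leq w uP) _; rewrite -p_last.
  by apply: leq_trans (dist_path_leq p_path) _; rewrite -ltnS -vk vu -p_size.
(* Lower bound: a core vertex nearest to [w] is at most one step further from [v]. *)
have [u' u'P ->] := core_dist_attained w u0P.
rewrite -ltnS -vk; exact: leq_trans (core_dist_leq v u'P) (dist_adj_leq _ vw).
Qed.

Lemma core_dist_onto (u0 : 'I_n) (i : nat) :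
  u0 \in core -> (i <= max_core_dist G U lambda)%N -> exists v, cdist v = i.
Proof.
rewrite /max_core_dist => u0P; have [|v ->] := @bigop.eq_bigmax 'I_n cdist.
  by apply/card_gt0P; exists u0.
(* Descend from the maximum, attained at [v], by induction on the gap between it and [i]. *)
move=> iv; rewrite -(subKn iv); elim: (_ - i)%N => [|k [w wk]].
  by exists v; rewrite subn0.
case: (ltnP k (cdist v)) => kv; last first.
  (* The truncated difference is already 0, so [w] serves again. *)
  by exists w; rewrite wk subnS; move: kv; rewrite -subn_eq0 => /eqP->.
by apply: (@core_dist_pred u0 w) => //; rewrite wk subnSK.
Qed.

End CoreDistance.

Theorem proposition2p1 (R : realType) (n : nat) (G : connected_graph n)
    (U : 'M[R]_n) (hU : universal_adjacency G U)
    (lambda : R) (hlambda : eigenvalue U lambda) :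
  partition (core_layers G U lambda) [set: 'I_n].
Proof.
have [u0 u0P] := exists_core_vertex (universal_adjacency_sym hU) hlambda.
apply/and3P; split.
- rewrite -subTset; apply/subsetP=> v _.
  have vD : (core_dist G U lambda v < (max_core_dist G U lambda).+1)%N.
    by rewrite ltnS; apply: (leq_bigmax (F := core_dist G U lambda)).
  apply/bigcupP; exists (core_layer G U lambda (Ordinal vD)); last by rewrite inE.
  exact: imset_f.
(* A vertex common to two layers has both indices as its core distance, so the layers coincide. *)
- apply/trivIsetP=> _ _ /imsetP[i _ ->] /imsetP[j _ ->]; apply: contraR.
  by case/pred0Pn=> v; rewrite /= !inE => /andP[/eqP <- /eqP <-].
- apply/imsetP=> -[i _ /esym/setP i0].
  have [v vi] := core_dist_onto (G := G) u0P (leq_ord i).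
  by have := i0 v; rewrite !inE vi eqxx.
Qed.
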